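(* Let $R>0$ and let $D\subset\mathbb{H}^2$ be an open ball of radius $R$ in the hyperbolic plane. If $F\colon D\to\mathbb{R}$ is a $\theta$-barrier for $D$, then $\theta\ge\frac{1}{2^7}\sqrt R-\frac14$.
   Context: $\mathbb{H}^2$ is the hyperbolic plane: the complete simply connected Riemannian 2-manifold of constant sectional curvature $-1$, with metric $\langle\cdot,\cdot\rangle$ and distance $d$. The open ball of radius $R$ and center $c$ is $B(c,R)=\{p\in\mathbb{H}^2:d(c,p)<R\}$. A set $D\subseteq \mathbb{H}^2$ is geodesically convex (g-convex) if for all $p,q\in D$ the geodesic segment from $p$ to $q$ lies in $D$; balls are g-convex. Barriers. Let $D\subseteq\mathbb{H}^2$ be open and g-convex. For a three times continuously differentiable $F\colon D\to\mathbb{R}$, let $\nabla F(p)\in T_p\mathbb{H}^2$ be the Riemannian gradient, $(\nabla^2F)_p$ the Riemannian Hessian (a symmetric bilinear form on $T_p\mathbb{H}^2$), and $(\nabla^3F)_p$ the third covariant derivative, i.e. the covariant derivative of the Hessian (a trilinear form, in general not symmetric). $F$ is strongly $1$-self-concordant if for all $p\in D$ and $u,v,w\in T_p\mathbb{H}^2$, $$|(\nabla^3F)_p(u,v,w)|\le 2\sqrt{(\nabla^2F)_p(u,u)}\sqrt{(\nabla^2F)_p(v,v)}\sqrt{(\nabla^2F)_p(w,w)},$$ and the epigraph $\{(p,t): p\in D,\ t\ge F(p)\}$ is a closed subset of $\mathbb{H}^2\times\mathbb{R}$. For a finite real number $\theta\ge 0$, $F$ is a $\theta$-barrier for $D$ if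 it is strongly $1$-self-concordant, $(\nabla^2F)_p\succ0$ for all $p\in D$, and $\max_{0\neq v\in T_p\mathbb{H}^2}\frac{\langle\nabla F(p),v\rangle}{\sqrt{(\nabla^2F)_p(v,v)}}\le\sqrt\theta$ for all $p\in D$. *)

(* Defs.v *)
From Stdlib Require Import Reals Lra Psatz.
From Coquelicot Require Import Coquelicot.
Open Scope R_scope.

(** The hyperbolic plane is realized as the upper half-plane [y > 0] with the
    metric [(dx^2 + dy^2) / y^2], of constant curvature [-1].  A point is a
    pair [(x, y)]; a tangent vector at any point is the pair of its components
    in the coordinate frame [(d/dx, d/dy)]. *)

Definition H2 (p : R * R) : Prop := 0 < snd p.

Inductive coord := cx | cy.

Definition sumc (f : coord -> R) : R := f cx + f cy.

Definition component (u : R * R) (i : coord) : R :=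
  match i with cx => fst u | cy => snd u end.

Definition metric (i j : coord) (p : R * R) : R :=
  match i, j with
  | cx, cx | cy, cy => / (snd p) ^ 2
  | _, _ => 0
  end.

Definition metric_inv (i j : coord) (p : R * R) : R :=
  match i, j with
  | cx, cx | cy, cy => (snd p) ^ 2
  | _, _ => 0
  end.

Lemma metric_invE (p : R * R) (i k : coord) : H2 p ->
  sumc (fun j => metric i j p * metric_inv j k p) =
  match i, k with cx, cx | cy, cy => 1 | _, _ => 0 end.
Proof.
unfold H2, sumc; destruct i, k; simpl; intros; field; lra.
Qed.

Definition inner (p u v : R * R) : R :=
  sumc (fun i => sumc (fun j => metric i j p * component u i * component v j)).

(** ** Riemannian distance *)

Definition velocity (g : R -> R * R) (t : R) : R * R :=
  (Derive (fun s => fst (g s)) t, Derive (fun s => snd (g s)) t).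

(** Derivatives at the endpoints are two-sided: every [C^1] curve on [[0, 1]]
    is the restriction of such a [g], whose values outside [[0, 1]] play no
    role. *)
Definition C1_curve (g : R -> R * R) : Prop :=
  forall t, 0 <= t <= 1 ->
    H2 (g t) /\
    ex_derive (fun s => fst (g s)) t /\ ex_derive (fun s => snd (g s)) t /\
    continuous (velocity g) t.

Definition curve_length (g : R -> R * R) : R :=
  RInt (fun t => sqrt (inner (g t) (velocity g t) (velocity g t))) 0 1.

Definition hdist (p q : R * R) : R :=
  real (Glb_Rbar (fun l =>
    exists g, C1_curve g /\ g 0 = p /\ g 1 = q /\ l = curve_length g)).

Definition hball (c : R * R) (r : R) (p : R * R) : Prop :=
  H2 p /\ hdist c p < r.

(** ** Covariant derivatives of a function *)

Definition along (i : coord) (f : R * R -> R) (p : R * R) (t : R) : R :=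
  match i with cx => f (t, snd p) | cy => f (fst p, t) end.

Definition ex_partial (i : coord) (f : R * R -> R) (p : R * R) : Prop :=
  ex_derive (along i f p) (component p i).

Definition partial (i : coord) (f : R * R -> R) (p : R * R) : R :=
  Derive (along i f p) (component p i).

(** Meant for open [D]; the values of [f] outside [D] are then irrelevant. *)
Fixpoint Ck (n : nat) (D : R * R -> Prop) (f : R * R -> R) : Prop :=
  (forall p, D p -> continuous f p) /\
  match n with
  | O => True
  | S m => forall i, (forall p, D p -> ex_partial i f p) /\
                     Ck m D (partial i f)
  end.

(** [christoffel k i j] is the Levi-Civita symbol with upper index [k] and
    lower indices [i], [j]. *)
Definition christoffel (k i j : coord) (p : R * R) : R :=
  sumc (fun l => metric_inv k l p *
    (partial i (metric j l) p + partial j (metric i l) p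
     - partial l (metric i j) p) / 2).

Definition grad (F : R * R -> R) (p : R * R) : R * R :=
  (sumc (fun j => metric_inv cx j p * partial j F p),
   sumc (fun j => metric_inv cy j p * partial j F p)).

Definition hess_coef (F : R * R -> R) (i j : coord) (p : R * R) : R :=
  partial i (partial j F) p
  - sumc (fun k => christoffel k i j p * partial k F p).

Definition hess (F : R * R -> R) (p u v : R * R) : R :=
  sumc (fun i => sumc (fun j => hess_coef F i j p * component u i * component v j)).

(** Components of the covariant derivative of the Hessian; the last index is
    the direction of differentiation. *)
Definition nabla3_coef (F : R * R -> R) (i j k : coord) (p : R * R) : R :=
  partial k (hess_coef F i j) p
  - sumc (fun l => christoffel l k i p * hess_coef F l j p)
  - sumc (fun l => christoffel l k j p * hess_coef F i l p).

Definition nabla3 (F : R * R -> R) (p u v w : R * R) : R :=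
  sumc (fun i => sumc (fun j => sumc (fun k =>
    nabla3_coef F i j k p * component u i * component v j * component w k))).

(** ** Barriers *)

Definition epigraph (D : R * R -> Prop) (F : R * R -> R)
    (z : (R * R) * R) : Prop :=
  D (fst z) /\ F (fst z) <= snd z.

(** Since [H2] is open in [R * R], a subset of [H2 x R] is closed in
    [H2 x R] iff its complement in [H2 x R] is open in [(R * R) * R]. *)
Definition closed_H2R (E : (R * R) * R -> Prop) : Prop :=
  open (fun z : (R * R) * R => H2 (fst z) /\ ~ E z).

(** The nonnegativity of the Hessian is what gives meaning to the square roots
    ([sqrt] is [0] on negative reals). *)
Definition strongly_1_self_concordant (D : R * R -> Prop)
    (F : R * R -> R) : Prop :=
  Ck 3 D F /\
  (forall p u, D p -> 0 <= hess F p u u) /\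
  (forall p u v w, D p ->
     Rabs (nabla3 F p u v w) <=
     2 * sqrt (hess F p u u) * sqrt (hess F p v v) * sqrt (hess F p w w)) /\
  closed_H2R (epigraph D F).

Definition barrier (theta : R) (D : R * R -> Prop) (F : R * R -> R) : Prop :=
  0 <= theta /\
  strongly_1_self_concordant D F /\
  (forall p v, D p -> v <> (0, 0) -> 0 < hess F p v v) /\
  (forall p v, D p -> v <> (0, 0) ->
     inner p (grad F p) v / sqrt (hess F p v v) <= sqrt theta).

(* Main.v *)
Require Import Defs.
From Stdlib Require Import Reals Lra Psatz ClassicalEpsilon.
From Coquelicot Require Import Coquelicot.
Open Scope R_scope.

(** Maximum principle against an explicit radial bowl.  By the Ricci identity,
    the asymmetry of the third covariant derivative is [|n|^2 dF(v)] for
    [n] orthogonal to [v] of the same length, so self-concordance gives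
    [|n|^2 dF(v) <= 4 H(n,n) sqrt (H(v,v))] with [H] the Hessian of [F], while the
    gradient bound gives [dF(v)^2 <= theta H(v,v)].  Let [rho] be the distance to
    the center, [l = ln (cosh rho)] and [psi = - tau ln (L^2 - l^2)].  Since [psi]
    blows up on the boundary of the compact ball [l <= L], contained in [D] for
    [L = r/2] and [r] large, [F - psi] has an interior maximum [q].  There the
    gradients of [F] and [psi] agree and [H] is at most the Hessian of [psi], so
    [psi] would satisfy both inequalities at [q] with [v] the radial direction.
    For [tau = 2 theta] this is impossible once [L^2 > 336 theta]. *)

(** * Functions of class C^k on open sets *)

(** Lets the regularity of a barrier on [D] be used on a smaller ball whose openness is
    established. *)
Lemma Ck_sub (n : nat) (D D' : R * R -> Prop) (f : R * R -> R) :
  (forall p, D' p -> D p) -> Ck n D f -> Ck n D' f.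
Proof.
intros DD; revert f; induction n as [|n IH]; intros f [fC fD].
- split; [now auto | trivial].
- split; [now auto|]; intros i; split; [intros p Dp; apply fD; auto|].
  apply IH, fD.
Qed.

Lemma Ck_pred (n : nat) (D : R * R -> Prop) (f : R * R -> R) :
  Ck (S n) D f -> Ck n D f.
Proof.
revert f; induction n as [|n IH]; intros f [fC fD].
- exact (conj fC I).
- exact (conj fC (fun i => conj (proj1 (fD i)) (IH _ (proj2 (fD i))))).
Qed.

Lemma Ck_continuous (n : nat) (D : R * R -> Prop) (f : R * R -> R) (p : R * R) :
  Ck n D f -> D p -> continuous f p.
Proof. destruct n; intros [H _]; auto. Qed.

Lemma Ck_is_derive_along (n : nat) (D : R * R -> Prop) (f : R * R -> R) (i : coord)
    (p : R * R) :
  Ck (S n) D f -> D p -> is_derive (along i f p) (component p i) (partial i f p).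
Proof. intros [_ fD] Dp; apply Derive_correct, fD, Dp. Qed.

Lemma Ck_partial (n : nat) (D : R * R -> Prop) (f : R * R -> R) (i : coord) :
  Ck (S n) D f -> Ck n D (partial i f).
Proof. intros [_ fD]; apply fD. Qed.

Lemma continuous_continuity_2d (f : R * R -> R) (p : R * R) :
  continuous f p -> continuity_2d_pt (fun x y => f (x, y)) (fst p) (snd p).
Proof.
destruct p as [x y]; intros fC; apply continuity_2d_pt_filterlim; simpl.
apply filterlim_ext with f; [now intros [] | exact fC].
Qed.

Lemma open_pair (D : R * R -> Prop) (x y : R) :
  open D -> D (x, y) -> locally (x, y) (fun z => D (fst z, snd z)).
Proof.
intros Do Dxy; apply filter_imp with D; [now intros [] | now apply Do].
Qed.

Lemma Ck_Schwarz (D : R * R -> Prop) (f : R * R -> R) (p : R * R) :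
  open D -> Ck 2 D f -> D p ->
  partial cx (partial cy f) p = partial cy (partial cx f) p.
Proof.
destruct p as [x y]; intros Do fC Dp.
apply (Schwarz (fun u v => f (u, v)) x y).
- apply locally_2d_locally; apply filter_imp with (2 := open_pair _ _ _ Do Dp).
  intros [u v] Duv; simpl in Duv |- *.
  pose proof (fun i => Ck_is_derive_along _ _ _ i _ fC Duv) as H1.
  pose proof (fun i j => Ck_is_derive_along _ _ _ j _ (Ck_partial _ _ _ i fC) Duv) as H2.
  repeat split.
  + exists (partial cx f (u, v)); exact (H1 cx).
  + exists (partial cy f (u, v)); exact (H1 cy).
  + eexists; exact (H2 cy cx).
  + eexists; exact (H2 cx cy).
- exact (continuous_continuity_2d _ (x, y)
    (Ck_continuous _ _ _ _ (Ck_partial _ _ _ cx (Ck_partial _ _ _ cy fC)) Dp)).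
- exact (continuous_continuity_2d _ (x, y)
    (Ck_continuous _ _ _ _ (Ck_partial _ _ _ cy (Ck_partial _ _ _ cx fC)) Dp)).
Qed.

Definition line (p v : R * R) (t : R) : R * R :=
  (fst p + t * fst v, snd p + t * snd v).

Lemma line0 (p v : R * R) : line p v 0 = p.
Proof. destruct p; unfold line; simpl; f_equal; ring. Qed.

Lemma continuous_pair (U : UniformSpace) (f g : U -> R) (t : U) :
  continuous f t -> continuous g t -> continuous (fun s => (f s, g s)) t.
Proof.
intros fC gC; apply (continuous_comp_2 f g (fun x y => (x, y))); trivial.
apply continuous_ext with (fun z => z); [now intros [] | apply continuous_id].
Qed.

Lemma continuous_line (p v : R * R) (t : R) : continuous (line p v) t.
Proof.
apply (continuous_pair _ (fun t => fst p + t * fst v) (fun t => snd p + t * snd v));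
  apply (ex_derive_continuous (V := R_NormedModule)); auto_derive; trivial.
Qed.

(** Differentiability in both variables follows from [partial cx f] existing nearby and being
    continuous at the point, together with [partial cy f] existing at the point; the chain rule
    along the line then applies. *)
Lemma Ck_is_derive_line (n : nat) (D : R * R -> Prop) (f : R * R -> R)
    (p v : R * R) (t : R) :
  open D -> Ck (S n) D f -> D (line p v t) ->
  is_derive (fun s => f (line p v s)) t
    (fst v * partial cx f (line p v t) + snd v * partial cy f (line p v t)).
Proof.
intros Do fC Dt; set (q := line p v t).
assert (Hd : differentiable_pt_lim (fun x y => f (x, y)) (fst q) (snd q)
               (partial cx f q) (partial cy f q)).
{ apply filterdiff_differentiable_pt_lim.
  apply (is_derive_filterdiff (fun x y => f (x, y)) (fst q) (snd q)
           (fun x y => partial cx f (x, y)) (partial cy f q)).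
  - apply filter_imp with (2 := open_pair _ _ _ Do Dt).
    intros z Dz; exact (Ck_is_derive_along _ _ _ cx _ fC Dz).
  - exact (Ck_is_derive_along _ _ _ cy _ fC Dt).
  - apply continuous_ext with (partial cx f); [now intros []|].
    exact (Ck_continuous _ _ _ _ (Ck_partial _ _ _ cx fC) Dt). }
apply is_derive_Reals.
replace (fst v * _ + _) with
  (partial cx f q * fst v + partial cy f q * snd v) by ring.
apply (derivable_pt_lim_comp_2d (fun x y => f (x, y))
         (fun s => fst p + s * fst v) (fun s => snd p + s * snd v)).
- exact Hd.
- apply is_derive_Reals; auto_derive; trivial; ring.
- apply is_derive_Reals; auto_derive; trivial; ring.
Qed.

(** If [d2] were positive, [dg], which vanishes at [0], would be positive just to the right of [0],
    and the mean value theorem would make [g] exceed [g 0] there. *)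
Lemma second_derivative_test (g dg : R -> R) (d2 : R) :
  locally 0 (fun t => is_derive g t (dg t)) -> is_derive dg 0 d2 ->
  locally 0 (fun t => g t <= g 0) -> dg 0 = 0 /\ d2 <= 0.
Proof.
intros Hg Hd Hm.
destruct (filter_and _ _ Hg Hm) as [e He].
assert (Hin : forall t, Rabs t < e -> is_derive g t (dg t) /\ g t <= g 0).
{ intros t Ht; apply He; unfold ball; simpl; unfold AbsRing_ball, abs, minus, plus, opp; simpl.
  now replace (t + - 0) with t by ring. }
assert (e_gt0 := cond_pos e).
assert (D0 : dg 0 = 0).
{ assert (H0 : is_derive g 0 (dg 0)) by (apply Hin; now rewrite Rabs_R0).
  apply is_derive_Reals in H0.
  apply (deriv_maximum g (-e) e 0 (exist _ (dg 0) H0)); [lra|lra|].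
  intros x H1 H2; apply Hin; apply Rabs_def1; lra. }
split; [exact D0|].
destruct (Rle_lt_dec d2 0) as [|H2]; [assumption|exfalso].
apply is_derive_Reals in Hd.
destruct (Hd (d2 / 2)) as [d Hd']; [lra|].
assert (d_gt0 := cond_pos d).
set (m := Rmin d e / 2).
assert (Hm2 : 0 < m /\ m < d /\ m < e).
{ unfold m; assert (0 < Rmin d e) by (now apply Rmin_pos).
  assert (H1 := Rmin_l d e); assert (H3 := Rmin_r d e); lra. }
destruct (MVT_cor2 g dg 0 m) as [z [Hgz Hz]]; [lra| |].
{ intros x Hx; apply is_derive_Reals, Hin, Rabs_def1; lra. }
assert (Hp : 0 < dg z).
{ assert (Hq := Hd' z ltac:(lra) ltac:(rewrite Rabs_right; lra)).
  rewrite Rplus_0_l, D0, Rminus_0_r in Hq.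
  apply Rabs_def2 in Hq.
  assert (0 < dg z / z) by lra.
  replace (dg z) with (dg z / z * z) by (field; lra).
  nra. }
assert (Hgm := proj2 (Hin m ltac:(rewrite Rabs_right; lra))).
nra.
Qed.

(** * Hessian and third derivative in coordinates *)

Lemma partial_metric (l i j : coord) (p : R * R) : H2 p ->
  partial l (metric i j) p =
  match l, i, j with cy, cx, cx | cy, cy, cy => - 2 / snd p ^ 3 | _, _, _ => 0 end.
Proof.
intros Hp; destruct p as [x y]; unfold H2, partial, along in *; apply is_derive_unique.
destruct l, i, j; simpl in *; auto_derive; trivial;
  solve [reflexivity | lra | field; lra | apply Rgt_not_eq; nra].
Qed.

Lemma christoffelE (k i j : coord) (p : R * R) : H2 p ->
  christoffel k i j p =
  match k, i, j with
  | cx, cx, cy | cx, cy, cx | cy, cy, cy => - / snd p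
  | cy, cx, cx => / snd p
  | _, _, _ => 0
  end.
Proof.
intros Hp; unfold christoffel, sumc; rewrite !partial_metric by exact Hp.
unfold H2 in Hp; destruct k, i, j; simpl; field; lra.
Qed.

Lemma hess_coefE (F : R * R -> R) (i j : coord) (p : R * R) : H2 p ->
  hess_coef F i j p =
  partial i (partial j F) p +
  match i, j with
  | cx, cx => - partial cy F p / snd p
  | cy, cy => partial cy F p / snd p
  | _, _ => partial cx F p / snd p
  end.
Proof.
intros Hp; unfold hess_coef, sumc; rewrite !christoffelE by exact Hp.
unfold H2 in Hp; destruct i, j; field; lra.
Qed.

Lemma H2_along_cy (p : R * R) : H2 p -> locally (snd p) (fun t => H2 (fst p, t)).
Proof. intros Hp; exact (open_gt 0 (snd p) Hp). Qed.

Lemma is_derive_div_id (g : R -> R) (y l : R) :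
  y <> 0 -> is_derive g y l -> is_derive (fun t => g t / t) y (l / y - g y / y ^ 2).
Proof.
intros y0 Hg; auto_derive.
- repeat split; [now exists l | exact y0].
- change (Derive (fun t => g t) y) with (Derive g y).
  rewrite (is_derive_unique _ _ _ Hg); field; exact y0.
Qed.

(* Ricci identity: the right-hand side is the curvature term. *)
Lemma nabla3_coef_swap (D : R * R -> Prop) (F : R * R -> R) (j : coord) (p : R * R) :
  open D -> Ck 3 D F -> D p -> H2 p ->
  nabla3_coef F cx j cy p - nabla3_coef F cy j cx p =
  match j with
  | cx => partial cy F p / snd p ^ 2
  | cy => - partial cx F p / snd p ^ 2
  end.
Proof.
intros Do FC Dp Hp.
assert (S1 := Ck_Schwarz D F p Do (Ck_pred _ _ _ FC) Dp).
assert (S2 := fun i => Ck_Schwarz D (partial i F) p Do (Ck_partial _ _ _ i FC) Dp).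
pose proof (fun i k => Ck_is_derive_along 1 _ _ k p (Ck_partial _ _ _ i FC) Dp) as D2.
pose proof (fun i j k => Ck_is_derive_along 0 _ _ k p
  (Ck_partial _ _ _ i (Ck_partial _ _ _ j FC)) Dp) as D3.
destruct p as [x y]; unfold H2 in Hp; simpl in Hp.
assert (Ey : forall i, partial cy (hess_coef F cx i) (x, y) =
  partial cy (partial cx (partial i F)) (x, y) +
  match i with
  | cx => - partial cy (partial cy F) (x, y) / y + partial cy F (x, y) / y ^ 2
  | cy => partial cy (partial cx F) (x, y) / y - partial cx F (x, y) / y ^ 2
  end).
{ intros i; unfold partial at 1; simpl.
  rewrite (Derive_ext_loc _ (fun t => partial cx (partial i F) (x, t) +
      match i with cx => - partial cy F (x, t) / t | cy => partial cx F (x, t) / t end)).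
  2: { apply filter_imp with (2 := H2_along_cy (x, y) Hp); intros t Ht.
       unfold along; simpl fst; rewrite hess_coefE by exact Ht; destruct i; reflexivity. }
  apply is_derive_unique; apply (is_derive_plus (V := R_NormedModule)).
  - exact (D3 cx i cy).
  - destruct i.
    + replace (_ + _) with (- partial cy (partial cy F) (x, y) / y
        - - partial cy F (x, y) / y ^ 2) by (field; lra).
      apply (is_derive_div_id (fun t => - partial cy F (x, t))); [lra|].
      exact (is_derive_opp _ _ _ (D2 cy cy)).
    + apply (is_derive_div_id (fun t => partial cx F (x, t))); [lra|].
      exact (D2 cx cy). }
assert (Ex : forall i, partial cx (hess_coef F cy i) (x, y) =
  partial cx (partial cy (partial i F)) (x, y) + partial cx (partial i F) (x, y) / y).
{ intros i; unfold partial at 1; simpl.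
  (* Moving along [cx] keeps the height [y], so the formula for the coefficient holds on the whole
     line; along [cy] it holds only near the point. *)
  rewrite (Derive_ext _ (fun t => partial cy (partial i F) (t, y) + partial i F (t, y) / y)).
  2: { intros t; unfold along; simpl snd; rewrite hess_coefE by exact Hp; destruct i; reflexivity. }
  apply is_derive_unique; apply (is_derive_plus (V := R_NormedModule)).
  - exact (D3 cy i cx).
  - apply (is_derive_ext (fun t => / y * partial i F (t, y)));
      [intros t; apply Rmult_comm|].
    unfold Rdiv; rewrite (Rmult_comm _ (/ y)).
    exact (is_derive_scal _ x (/ y) _ (D2 i cx)). }
unfold nabla3_coef, sumc; rewrite Ex, Ey, !christoffelE, !hess_coefE by exact Hp.
rewrite S2; destruct j; simpl; rewrite ?S1; field; lra.
Qed.

Lemma hessE (F : R * R -> R) (p v : R * R) : H2 p ->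
  hess F p v v =
  fst v * (fst v * partial cx (partial cx F) p + snd v * partial cy (partial cx F) p) +
  snd v * (fst v * partial cx (partial cy F) p + snd v * partial cy (partial cy F) p) -
  partial cy F p / snd p * (fst v ^ 2 - snd v ^ 2) +
  2 * partial cx F p / snd p * fst v * snd v.
Proof.
intros Hp; unfold hess, sumc; rewrite !hess_coefE by exact Hp; simpl.
unfold H2 in Hp; field; lra.
Qed.

Lemma inner_gradE (F : R * R -> R) (p v : R * R) : H2 p ->
  inner p (grad F p) v = partial cx F p * fst v + partial cy F p * snd v.
Proof.
intros Hp; unfold inner, grad, sumc; simpl; unfold H2 in Hp; field; lra.
Qed.

(** Exchanging the two outer arguments contracts [nabla3_coef] with [n_i v_k - v_i n_k]. This is
    antisymmetric, so in dimension two only the differences computed in [nabla3_coef_swap] survive,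
    with factor [- (fst v ^ 2 + snd v ^ 2)]. *)
Lemma nabla3_swap (D : R * R -> Prop) (F : R * R -> R) (p v : R * R) :
  open D -> Ck 3 D F -> D p -> H2 p ->
  let n := (- snd v, fst v) in
  nabla3 F p n n v - nabla3 F p v n n =
  (fst v ^ 2 + snd v ^ 2) / snd p ^ 2 *
  (partial cx F p * fst v + partial cy F p * snd v).
Proof.
intros Do FC Dp Hp n.
assert (Sx := nabla3_coef_swap D F cx p Do FC Dp Hp).
assert (Sy := nabla3_coef_swap D F cy p Do FC Dp Hp).
unfold nabla3, sumc; simpl.
set (a := nabla3_coef F cx cx cy p) in *; set (a' := nabla3_coef F cy cx cx p) in *.
set (b := nabla3_coef F cx cy cy p) in *; set (b' := nabla3_coef F cy cy cx p) in *.
replace a with (a' + partial cy F p / snd p ^ 2) by lra.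
replace b with (b' + - partial cx F p / snd p ^ 2) by lra.
unfold H2 in Hp; field; lra.
Qed.

(** * Geodesics and balls *)

(** The curve is the geodesic leaving [c] with constant speed [T] in the unit direction [(m, n)].
    With [W = cosh (T s) - n sinh (T s)] and [V = W' / T], the identity [m^2 + V^2 = W^2] makes the
    speed constant. *)
Lemma geodesic (c : R * R) (m n T : R) :
  H2 c -> m ^ 2 + n ^ 2 = 1 -> 0 <= T ->
  let w := cosh T - n * sinh T in
  exists g, C1_curve g /\ g 0 = c /\
    g 1 = (fst c + snd c * m * sinh T / w, snd c / w) /\ T = curve_length g.
Proof.
intros Hb Hmn HT w; destruct c as [a b]; unfold H2 in Hb; cbn [fst snd] in Hb |- *.
set (W := fun s => (1 - n) / 2 * exp (T * s) + (1 + n) / 2 * exp (- (T * s))).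
set (S := fun s => (exp (T * s) - exp (- (T * s))) / 2).
set (V := fun s => (1 - n) / 2 * exp (T * s) - (1 + n) / 2 * exp (- (T * s))).
assert (HW : forall s, 0 < W s).
{ intros s; unfold W.
  assert (H1 := exp_pos (T * s)); assert (H2' := exp_pos (- (T * s))).
  assert (-1 <= n <= 1) by (split; nra).
  destruct (Rlt_le_dec n 1).
  - assert (0 < (1 - n) / 2 * exp (T * s)) by (apply Rmult_lt_0_compat; lra).
    assert (0 <= (1 + n) / 2 * exp (- (T * s))) by (apply Rmult_le_pos; lra). lra.
  - replace n with 1 by lra. lra. }
assert (He : forall s, exp (- (T * s)) = / exp (T * s)) by (intros; apply exp_Ropp).
pose (g := fun s => (a + b * m * S s / W s, b / W s)).
assert (Dx : forall s, is_derive (fun s => fst (g s)) s (b * m * T / W s ^ 2)).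
{ intros s; assert (Hs := HW s); unfold g, S, W in *; simpl fst; auto_derive; [lra|].
  rewrite He in *; assert (H1 := exp_pos (T * s)); set (e := exp (T * s)) in *.
  field; split; [lra|].
  apply Rgt_not_eq; replace (_ + _) with
    (2 * e * ((1 - n) / 2 * e + (1 + n) / 2 * / e)) by (field; lra).
  apply Rmult_lt_0_compat; lra. }
assert (Dy : forall s, is_derive (fun s => snd (g s)) s (- (b * T * V s) / W s ^ 2)).
{ intros s; assert (Hs := HW s); unfold g, V, W in *; simpl snd; auto_derive; [lra|].
  set (e := exp (T * s)) in *; set (e' := exp (- (T * s))) in *.
  field; lra. }
assert (Hv : forall s, velocity g s = (b * m * T / W s ^ 2, - (b * T * V s) / W s ^ 2)).
{ intros s; unfold velocity; f_equal; apply is_derive_unique; auto. }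
assert (HVW : forall s, m ^ 2 + V s ^ 2 = W s ^ 2).
{ intros s; unfold V, W; replace (m ^ 2) with (1 - n ^ 2) by lra.
  rewrite He; assert (H1 := exp_pos (T * s)); field; lra. }
exists g; repeat split.
- unfold H2, g; simpl; apply Rdiv_lt_0_compat; auto.
- eexists; apply Dx.
- eexists; apply Dy.
- apply continuous_ext with (fun s => (b * m * T / W s ^ 2, - (b * T * V s) / W s ^ 2));
    [intros s; now rewrite Hv|].
  assert (H1 := HW t).
  apply continuous_pair; apply (ex_derive_continuous (V := R_NormedModule));
    unfold W, V in *; auto_derive; (split; [|exact I] || idtac); try (apply Rgt_not_eq; nra).
- unfold g, S, W; rewrite Rmult_0_r, Ropp_0, exp_0; f_equal; field; lra.
- unfold g, S, W, w, cosh, sinh; rewrite Rmult_1_r.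
  replace ((exp T + exp (- T)) / 2 - n * ((exp T - exp (- T)) / 2)) with
    ((1 - n) / 2 * exp T + (1 + n) / 2 * exp (- T)) by field.
  reflexivity.
- unfold curve_length; rewrite (RInt_ext _ (fun _ => T)).
  + rewrite RInt_const; unfold scal; simpl; unfold mult; simpl; ring.
  + intros s _; assert (Hs := HW s); rewrite Hv.
    unfold inner, sumc, g; simpl.
    transitivity (sqrt (T ^ 2)); [f_equal|now apply sqrt_pow2].
    transitivity (T ^ 2 * (m ^ 2 + V s ^ 2) / W s ^ 2).
    * field; lra.
    * rewrite HVW; field; lra.
Qed.

(** Half-plane formula for the hyperbolic cosine of the distance, smooth also at [c]. It is tied to
    [hdist] through the inclusion [hball_cosh_dist]. *)
Definition cosh_dist (c p : R * R) : R :=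
  ((fst p - fst c) ^ 2 + snd p ^ 2 + snd c ^ 2) / (2 * snd c * snd p).

Lemma cosh_dist_ge1 (c p : R * R) : H2 c -> H2 p -> 1 <= cosh_dist c p.
Proof.
unfold H2, cosh_dist; intros Hc Hp.
assert (0 < snd c * snd p) by (now apply Rmult_lt_0_compat).
apply Rle_div_r; [lra|].
assert (H1 := pow2_ge_0 (fst p - fst c)); assert (H2' := pow2_ge_0 (snd p - snd c)).
nra.
Qed.

(** For [u = cosh_dist c p] and [T = arcosh u], one has [exp T = u + sqrt (u^2 - 1) < 2 u < exp r].
    Solving the endpoint formula of [geodesic] for the direction gives a curve of length [T < r]
    from [c] to [p]. *)
Lemma hball_cosh_dist (c p : R * R) (r : R) :
  H2 c -> H2 p -> 0 < r -> 2 * cosh_dist c p < exp r -> hball c r p.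
Proof.
intros Hc Hp Hr Hu; split; [exact Hp|].
assert (u1 := cosh_dist_ge1 c p Hc Hp); set (u := cosh_dist c p) in *.
set (S := sqrt (u ^ 2 - 1)).
assert (S0 : 0 <= S) by apply sqrt_pos.
assert (S2 : S ^ 2 = u ^ 2 - 1) by (apply pow2_sqrt; nra).
assert (Su : S < u) by nra.
set (T := ln (u + S)).
assert (eT : exp T = u + S) by (apply exp_ln; lra).
assert (eNT : exp (- T) = u - S).
{ rewrite exp_Ropp, eT; apply Rmult_eq_reg_l with (u + S); [|lra].
  rewrite Rinv_r by lra; nra. }
assert (T0 : 0 <= T) by (unfold T; rewrite <- ln_1; apply ln_le; lra).
assert (Tr : T < r) by (apply exp_lt_inv; lra).
assert (HX : ((fst p - fst c) / snd p) ^ 2 + (u - snd c / snd p) ^ 2 = S ^ 2).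
{ rewrite S2; unfold u, cosh_dist; unfold H2 in *; field; lra. }
(* If [S = 0], the points coincide and any unit direction serves; otherwise [HX] says that the
   quotients by [S] form a unit vector. *)
assert (Hmn : exists m n, m ^ 2 + n ^ 2 = 1 /\
  m * S = (fst p - fst c) / snd p /\ n * S = u - snd c / snd p).
{ destruct (Req_dec S 0) as [E|E].
  - exists 0, 1; rewrite E in *.
    set (X := (fst p - fst c) / snd p) in *; set (Y := u - snd c / snd p) in *.
    repeat split; nra.
  - exists ((fst p - fst c) / snd p / S), ((u - snd c / snd p) / S).
    set (X := (fst p - fst c) / snd p) in *; set (Y := u - snd c / snd p) in *.
    repeat split; [|field; exact E|field; exact E].
    replace (_ + _) with ((X ^ 2 + Y ^ 2) / S ^ 2) by (field; exact E).
    rewrite HX; field; exact E. }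
destruct Hmn as [m [n [Hmn [Hm Hn]]]].
destruct (geodesic c m n T Hc Hmn T0) as [g [g1 [g2 [g3 g4]]]].
assert (Hs : sinh T = S) by (unfold sinh; rewrite eT, eNT; field).
assert (Hch : cosh T = u) by (unfold cosh; rewrite eT, eNT; field).
rewrite Hs, Hch, Hn in g3.
assert (Hg1 : g 1 = p).
{ rewrite g3; replace (u - (u - snd c / snd p)) with (snd c / snd p) by ring.
  rewrite (Rmult_assoc (snd c)), Hm; unfold H2 in *.
  destruct p as [x y]; simpl in *; f_equal; field; lra. }
unfold hdist.
(* An infimum of minus infinity is not excluded here: [real] then returns [0], which is below [r]
   too. *)
match goal with |- real (Glb_Rbar ?E) < r =>
  destruct (Glb_Rbar_correct E) as [Hlb _]; specialize (Hlb T);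
  destruct (Glb_Rbar E) as [l| |] end; simpl in *.
- assert (l <= T) by (apply Hlb; exists g; auto). lra.
- exfalso; apply Hlb; exists g; auto.
- exact Hr.
Qed.

(** * Maxima of continuous functions on a rectangle *)

(** Composing with [atan] gives a finite supremum [m] for free. If it is not attained, each point
    has a neighborhood where [atan f] stays below [m] by a margin; compactness makes the margin
    uniform, which contradicts the choice of [m]. *)
Lemma rectangle_max (f : R * R -> R) (a b a' b' : R) :
  a <= b -> a' <= b' ->
  (forall x y, a <= x <= b -> a' <= y <= b' -> continuous f (x, y)) ->
  exists q, (a <= fst q <= b /\ a' <= snd q <= b') /\
    forall x y, a <= x <= b -> a' <= y <= b' -> f (x, y) <= f q.
Proof.
intros ab ab' fC.
apply NNPP; intros Hno.
assert (Hex : forall x y, a <= x <= b -> a' <= y <= b' ->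
  exists x' y', a <= x' <= b /\ a' <= y' <= b' /\ f (x, y) < f (x', y')).
{ intros x y Hx Hy; apply NNPP; intros H; apply Hno; exists (x, y).
  split; [auto|]; intros x' y' Hx' Hy'; apply Rnot_lt_le; intros Hlt.
  apply H; exists x', y'; auto. }
destruct (completeness
  (fun v => exists x y, a <= x <= b /\ a' <= y <= b' /\ v = atan (f (x, y)))) as [m [Hm Hlub]].
{ exists (PI / 2); intros v [x [y [_ [_ ->]]]]; apply Rlt_le, atan_bound. }
{ exists (atan (f (a, a'))), a, a'; repeat split; lra. }
assert (Hlt : forall x y, a <= x <= b -> a' <= y <= b' -> atan (f (x, y)) < m).
{ intros x y Hx Hy; destruct (Hex x y Hx Hy) as [x' [y' [Hx' [Hy' H]]]].
  apply Rlt_le_trans with (atan (f (x', y'))); [now apply atan_increasing|].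
  apply Hm; exists x', y'; auto. }
assert (Hgap : forall x y, exists e : posreal, a <= x <= b -> a' <= y <= b' ->
  forall u v, Rabs (u - x) < e -> Rabs (v - y) < e -> atan (f (u, v)) <= m - e).
{ intros x y.
  destruct (classic ((a <= x <= b) /\ (a' <= y <= b'))) as [[Hx Hy]|H];
    [|exists (mkposreal 1 Rlt_0_1); intros; exfalso; auto].
  assert (gC : continuous (fun p => atan (f p)) (x, y)).
  { apply (continuous_comp f atan); [now apply fC|apply continuous_atan]. }
  assert (H := Hlt x y Hx Hy); set (k := (m - atan (f (x, y))) / 2).
  assert (k0 : 0 < k) by (unfold k; lra).
  destruct (continuous_continuity_2d _ _ gC (mkposreal k k0)) as [d Hd]; simpl in Hd.
  exists (mkposreal (Rmin d k) (Rmin_pos _ _ (cond_pos d) k0)); simpl.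
  intros _ _ u v Hu Hv.
  assert (H1 := Rmin_l d k); assert (H2 := Rmin_r d k).
  assert (H3 := Hd u v ltac:(lra) ltac:(lra)); apply Rabs_def2 in H3.
  unfold k in *; lra. }
pose (delta := fun x y => proj1_sig (constructive_indefinite_description _ (Hgap x y))).
assert (Hdelta : forall x y, a <= x <= b -> a' <= y <= b' -> forall u v,
  Rabs (u - x) < delta x y -> Rabs (v - y) < delta x y -> atan (f (u, v)) <= m - delta x y).
{ intros x y; unfold delta; apply proj2_sig. }
destruct (compactness_value_2d a b a' b' delta) as [d Hd].
assert (d0 := cond_pos d).
assert (m <= m - d); [|lra].
apply Hlub; intros v [x [y [Hx [Hy ->]]]].
(* [compactness_value_2d] provides the nearby center [(u, v)] only under a double negation, hence
   the argument by contradiction. *)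
apply Rnot_lt_le; intros Hv; apply (Hd x y Hx Hy).
intros [u [v [Hu [Hv' [H1 [H2 H3]]]]]].
assert (H4 := Hdelta u v Hu Hv' x y H1 H2); lra.
Qed.

(** * The comparison bowl *)

Lemma open_H2 : open H2.
Proof.
apply (open_comp snd (fun y => 0 < y)); [|apply open_gt].
intros [x y] _; apply continuous_snd.
Qed.

Lemma continuous_cosh_dist (c p : R * R) : H2 c -> H2 p -> continuous (cosh_dist c) p.
Proof.
unfold H2; intros Hc Hp.
assert (Hx : continuous (fun p : R * R => fst p - fst c) p).
{ apply (continuous_minus fst (fun _ => fst c)); [|apply continuous_const].
  destruct p; apply continuous_fst. }
assert (Hy : continuous (fun p : R * R => snd p) p) by (destruct p; apply continuous_snd).
assert (Hm : forall f g : R * R -> R, continuous f p -> continuous g p ->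
  continuous (fun p => f p * g p) p) by (intros; now apply (continuous_mult f g)).
assert (Hs : forall f : R * R -> R, continuous f p -> continuous (fun p => f p ^ 2) p).
{ intros f Hf; simpl; apply Hm; [exact Hf|]; apply Hm; [exact Hf|apply continuous_const]. }
unfold cosh_dist, Rdiv; apply Hm.
- apply (continuous_plus (fun p : R * R => (fst p - fst c) ^ 2 + snd p ^ 2) (fun _ => snd c ^ 2));
    [|apply continuous_const].
  apply (continuous_plus (fun p : R * R => (fst p - fst c) ^ 2) (fun p => snd p ^ 2)); auto.
- apply (continuous_comp (fun p : R * R => 2 * snd c * snd p) Rinv).
  + apply Hm; [apply continuous_const|exact Hy].
  + apply continuous_Rinv; nra.
Qed.

(** The bowl is [- tau * ln (gap c L p)], a function of [ln (cosh rho)]; the gap vanishes where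
    [cosh_dist c p = exp L]. *)
Definition gap (c : R * R) (L : R) (p : R * R) : R := L ^ 2 - ln (cosh_dist c p) ^ 2.

Lemma continuous_gap (c p : R * R) (L : R) : H2 c -> H2 p -> continuous (gap c L) p.
Proof.
intros Hc Hp; apply (continuous_comp (cosh_dist c) (fun u => L ^ 2 - ln u ^ 2)).
- now apply continuous_cosh_dist.
- assert (H := cosh_dist_ge1 c p Hc Hp).
  apply (ex_derive_continuous (V := R_NormedModule)); auto_derive; lra.
Qed.

Lemma gap_gt0 (c p : R * R) (L : R) : H2 c -> H2 p -> 0 < L ->
  0 < gap c L p <-> cosh_dist c p < exp L.
Proof.
intros Hc Hp HL; assert (H := cosh_dist_ge1 c p Hc Hp); unfold gap.
assert (Hl : 0 <= ln (cosh_dist c p)) by (rewrite <- ln_1; apply ln_le; lra).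
split; intros H1.
- rewrite <- (exp_ln (cosh_dist c p)) by lra; apply exp_increasing; nra.
- apply ln_increasing in H1; [|lra]; rewrite ln_exp in H1; nra.
Qed.

Lemma open_cosh_ball (c : R * R) (L : R) : H2 c -> 0 < L ->
  open (fun p => H2 p /\ cosh_dist c p < exp L).
Proof.
intros Hc HL p [Hp Hu]; apply filter_and; [now apply open_H2|].
apply (continuous_cosh_dist c p Hc Hp (fun u => u < exp L)).
now apply (open_lt (exp L)).
Qed.

(** Each of the three squares in [(x - a)^2 + y^2 + b^2 <= 2 U b y] is at most the right-hand side.
    The ball thus lies in a compact coordinate rectangle away from the boundary [y = 0]. *)
Lemma cosh_ball_bounded (c p : R * R) (U : R) :
  H2 c -> H2 p -> cosh_dist c p <= U ->
  (fst c - 2 * U * snd c <= fst p <= fst c + 2 * U * snd c) /\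
  (snd c / (2 * U) <= snd p <= 2 * U * snd c).
Proof.
intros Hc Hp HU; assert (H1 := cosh_dist_ge1 c p Hc Hp).
unfold H2, cosh_dist in *; destruct c as [a b], p as [x y]; simpl fst in *; simpl snd in *.
assert (Hby : 0 < b * y) by (now apply Rmult_lt_0_compat).
assert (U0 : 0 < U) by lra.
apply Rle_div_l in HU; [|lra].
assert (HbU : 0 < b * U) by (now apply Rmult_lt_0_compat).
assert (Hy : y <= 2 * U * b).
{ apply Rnot_lt_le; intros H.
  assert (0 < y * (y - 2 * U * b)) by (apply Rmult_lt_0_compat; lra).
  assert (H2' := pow2_ge_0 (x - a)); nra. }
assert (Hx : (x - a) ^ 2 <= (2 * U * b) ^ 2).
{ assert (0 <= 2 * U * b * (2 * U * b - y)) by (apply Rmult_le_pos; nra).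
  nra. }
repeat split; [nra|nra| |exact Hy].
apply Rle_div_l; [lra|]; apply Rnot_lt_le; intros H.
assert (0 < b * (b - y * (2 * U))) by (apply Rmult_lt_0_compat; lra).
assert (H2' := pow2_ge_0 (x - a)); nra.
Qed.

(* [exp (F / tau) * gap], extended by [0], is continuous and is positive exactly inside the ball. *)
Lemma barrier_minus_bowl_max (c : R * R) (L tau : R) (F : R * R -> R) :
  H2 c -> 0 < L -> 0 < tau ->
  (forall p, H2 p -> cosh_dist c p <= exp L -> continuous F p) ->
  exists q, (H2 q /\ cosh_dist c q < exp L) /\
    forall p, H2 p -> cosh_dist c p < exp L ->
      F p + tau * ln (gap c L p) <= F q + tau * ln (gap c L q).
Proof.
intros Hc HL Ht FC.
set (U := exp L); assert (U0 : 1 < U) by (unfold U; rewrite <- exp_0; now apply exp_increasing).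
set (E := fun p => exp (F p / tau) * ((gap c L p + Rabs (gap c L p)) / 2)).
assert (Epos : forall p, 0 < gap c L p -> E p = exp (F p / tau + ln (gap c L p))).
{ intros p Hw; unfold E; rewrite Rabs_right by lra.
  rewrite exp_plus, exp_ln by exact Hw; f_equal; field. }
assert (Eneg : forall p, gap c L p <= 0 -> E p = 0).
{ intros p Hw; unfold E; rewrite Rabs_left1 by exact Hw; field. }
assert (Hb := Hc); unfold H2 in Hb.
assert (HbU : 0 < 2 * U * snd c) by (apply Rmult_lt_0_compat; lra).
assert (HbU' : 0 < snd c / (2 * U)) by (apply Rdiv_lt_0_compat; lra).
assert (cc : cosh_dist c c = 1) by (unfold cosh_dist; field; lra).
destruct (cosh_ball_bounded c c U Hc Hc ltac:(lra)) as [Hcx Hcy].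
destruct (rectangle_max E (fst c - 2 * U * snd c) (fst c + 2 * U * snd c)
  (snd c / (2 * U)) (2 * U * snd c)) as [q [[Hqx Hqy] Hq]]; [lra|lra| |].
- intros x y Hx Hy.
  assert (Hp : H2 (x, y)) by (unfold H2; simpl; lra).
  assert (wC := continuous_gap c (x, y) L Hc Hp).
  (* On the closed ball [F] is continuous, hence so is [E]; outside it the gap is negative nearby,
     so [E] is locally [0] whatever [F] does. *)
  destruct (Rle_lt_dec (cosh_dist c (x, y)) U) as [Hu|Hu].
  + apply (continuous_mult (fun p => exp (F p / tau))
             (fun p => (gap c L p + Rabs (gap c L p)) / 2)).
    * apply (continuous_comp (fun p => F p / tau) exp).
      -- apply (continuous_mult F (fun _ => / tau)); [now apply FC|apply continuous_const].
      -- apply (ex_derive_continuous (V := R_NormedModule)); auto_derive; trivial.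
    * apply (continuous_comp (gap c L) (fun w => (w + Rabs w) / 2)); [exact wC|].
      apply (continuous_mult (fun w => w + Rabs w) (fun _ => / 2)); [|apply continuous_const].
      apply (continuous_plus (fun w => w) Rabs); [apply continuous_id|apply continuous_Rabs].
  + assert (Hw : gap c L (x, y) < 0).
    { unfold gap; apply ln_increasing in Hu; [|lra].
      unfold U in Hu; rewrite ln_exp in Hu; nra. }
    apply continuous_ext_loc with (fun _ => 0); [|apply continuous_const].
    apply filter_imp with (fun p => gap c L p < 0);
      [intros p H; symmetry; apply Eneg; lra|].
    apply (wC (fun w => w < 0)), open_lt, Hw.
- exists q.
  assert (Hq2 : H2 q) by (unfold H2; lra).
  assert (Hw : 0 < gap c L q).
  (* [E] is positive at the center [c], so its maximum is positive and lies strictly inside the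
     ball. *)
  { assert (wc : 0 < gap c L c) by (apply gap_gt0; auto; rewrite cc; exact U0).
    assert (Hqc := Hq (fst c) (snd c) Hcx Hcy).
    replace (fst c, snd c) with c in Hqc by (now destruct c).
    rewrite (Epos c wc) in Hqc.
    apply Rnot_le_lt; intros Hn; rewrite (Eneg q Hn) in Hqc.
    assert (H := exp_pos (F c / tau + ln (gap c L c))); lra. }
  split; [split; [exact Hq2|now apply gap_gt0]|].
  intros p Hp Hu; destruct (cosh_ball_bounded c p U Hc Hp (Rlt_le _ _ Hu)) as [Hpx Hpy].
  assert (Hwp : 0 < gap c L p) by (now apply gap_gt0).
  assert (H := Hq (fst p) (snd p) Hpx Hpy).
  replace (fst p, snd p) with p in H by (now destruct p).
  rewrite !Epos in H by assumption.
  assert (H1 : F p / tau + ln (gap c L p) <= F q / tau + ln (gap c L q)).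
  { apply Rnot_lt_le; intros H1; apply exp_increasing in H1; lra. }
  apply (Rmult_le_compat_l tau) in H1; [|lra].
  replace (F p + _) with (tau * (F p / tau + ln (gap c L p))) by (field; lra).
  replace (F q + _) with (tau * (F q / tau + ln (gap c L q))) by (field; lra).
  exact H1.
Qed.

(** * Derivatives of the bowl and comparison at the maximum *)

Definition cosh_dist_dx (c p : R * R) : R := (fst p - fst c) / (snd c * snd p).

Definition cosh_dist_dy (c p : R * R) : R := / snd c - cosh_dist c p / snd p.

(** In the hyperbolic metric this reads [|grad (cosh rho)|^2 = sinh^2 rho]. *)
Lemma cosh_dist_grad_norm (c p : R * R) : H2 c -> H2 p ->
  cosh_dist_dx c p ^ 2 + cosh_dist_dy c p ^ 2 = (cosh_dist c p ^ 2 - 1) / snd p ^ 2.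
Proof.
unfold H2, cosh_dist_dx, cosh_dist_dy, cosh_dist; intros Hc Hp; field; lra.
Qed.

Lemma is_derive_cosh_dist_line (c p v : R * R) (t : R) :
  H2 c -> H2 (line p v t) ->
  is_derive (fun t => cosh_dist c (line p v t)) t
    (fst v * cosh_dist_dx c (line p v t) + snd v * cosh_dist_dy c (line p v t)).
Proof.
unfold H2, cosh_dist_dx, cosh_dist_dy, cosh_dist, line; cbn [fst snd]; intros Hc Hp.
auto_derive; [|field; lra].
repeat split; apply Rgt_not_eq; apply Rmult_lt_0_compat; lra.
Qed.

(* The covariant Hessian of [cosh_dist c] is [cosh_dist c] times the metric. *)
Lemma is_derive2_cosh_dist_line (c p v : R * R) :
  H2 c -> H2 p ->
  is_derive (fun t => fst v * cosh_dist_dx c (line p v t) +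
                      snd v * cosh_dist_dy c (line p v t)) 0
    (cosh_dist c p / snd p ^ 2 * (fst v ^ 2 + snd v ^ 2) +
     cosh_dist_dy c p / snd p * (fst v ^ 2 - snd v ^ 2) -
     2 * cosh_dist_dx c p / snd p * fst v * snd v).
Proof.
unfold H2, cosh_dist_dx, cosh_dist_dy, cosh_dist, line; cbn [fst snd]; intros Hc Hp.
auto_derive; rewrite ?Rmult_0_l, ?Rplus_0_r; [|field; lra].
repeat split; apply Rgt_not_eq; try lra; apply Rmult_lt_0_compat; lra.
Qed.

Lemma is_derive_ln_gap (L tau : R) (U dU : R -> R) (t : R) :
  0 < U t -> 0 < L ^ 2 - ln (U t) ^ 2 -> is_derive U t (dU t) ->
  is_derive (fun t => tau * ln (L ^ 2 - ln (U t) ^ 2)) t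
    (- (2 * tau * ln (U t) / (L ^ 2 - ln (U t) ^ 2) * (dU t / U t))).
Proof.
intros HU Hw HdU; auto_derive.
- repeat split; [now exists (dU t)|exact HU|].
  now replace (ln (U t) * (ln (U t) * 1)) with (ln (U t) ^ 2) by ring.
- change (Derive (fun t => U t) t) with (Derive U t).
  rewrite (is_derive_unique _ _ _ HdU); field; split; lra.
Qed.

(** With [phi(l) = - tau ln (L^2 - l^2)], the two coefficients are [phi''] and [phi'], while [s] and
    [d2U / U - s^2] are the first two derivatives of [ln U]. *)
Lemma is_derive2_ln_gap (L tau : R) (U dU : R -> R) (t d2U : R) :
  0 < U t -> 0 < L ^ 2 - ln (U t) ^ 2 -> is_derive U t (dU t) -> is_derive dU t d2U ->
  let l := ln (U t) in
  let w := L ^ 2 - l ^ 2 in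
  let s := dU t / U t in
  is_derive (fun t => - (2 * tau * ln (U t) / (L ^ 2 - ln (U t) ^ 2) * (dU t / U t))) t
    (- ((2 * tau / w + 4 * tau * l ^ 2 / w ^ 2) * s ^ 2 +
        2 * tau * l / w * (d2U / U t - s ^ 2))).
Proof.
intros HU Hw HdU Hd2U l w s; auto_derive.
- repeat split; try (now eexists; eauto); try lra.
- change (Derive (fun t => U t) t) with (Derive U t).
  change (Derive (fun t => dU t) t) with (Derive dU t).
  rewrite (is_derive_unique _ _ _ HdU), (is_derive_unique _ _ _ Hd2U).
  unfold s, w, l in *; field; split; lra.
Qed.

(** [f1] and [f2] are the first two derivatives of the bowl in [l = ln u], and [s = dl(v)]. As the
    Hessian of [u] is [u] times the metric, that of [l] is the metric minus [dl^2]. Coordinate lines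
    are not geodesics in general, but at [q] the gradients of [F] and the bowl agree, so comparing
    ordinary second derivatives compares the covariant Hessians. *)
Lemma bowl_touching (c q : R * R) (L tau : R) (F : R * R -> R) :
  let B p := H2 p /\ cosh_dist c p < exp L in
  H2 c -> 0 < L -> 0 < tau -> Ck 3 B F -> B q ->
  (forall p, B p -> F p + tau * ln (gap c L p) <= F q + tau * ln (gap c L q)) ->
  let u := cosh_dist c q in
  let w := gap c L q in
  let f1 := 2 * tau * ln u / w in
  let f2 := 2 * tau / w + 4 * tau * ln u ^ 2 / w ^ 2 in
  partial cx F q = f1 * (cosh_dist_dx c q / u) /\
  partial cy F q = f1 * (cosh_dist_dy c q / u) /\
  forall v, let s := (fst v * cosh_dist_dx c q + snd v * cosh_dist_dy c q) / u in
    hess F q v v <= f2 * s ^ 2 + f1 * ((fst v ^ 2 + snd v ^ 2) / snd q ^ 2 - s ^ 2).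
Proof.
intros B Hc HL Ht FC Bq Hmax u w f1 f2.
assert (Bo : open B) by (now apply open_cosh_ball).
assert (Hq := proj1 Bq).
assert (u1 : 1 <= u) by (now apply cosh_dist_ge1).
assert (w0 : 0 < w) by (now apply gap_gt0; [| | |apply Bq]).
assert (Hv : forall v,
  let dx := cosh_dist_dx c q in let dy := cosh_dist_dy c q in
  let dU := fst v * dx + snd v * dy in
  (fst v * partial cx F q + snd v * partial cy F q) + - (f1 * (dU / u)) = 0 /\
  (fst v * (fst v * partial cx (partial cx F) q + snd v * partial cy (partial cx F) q) +
   snd v * (fst v * partial cx (partial cy F) q + snd v * partial cy (partial cy F) q)) +
  - (f2 * (dU / u) ^ 2 + f1 * ((u / snd q ^ 2 * (fst v ^ 2 + snd v ^ 2) +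
     dy / snd q * (fst v ^ 2 - snd v ^ 2) - 2 * dx / snd q * fst v * snd v) / u
     - (dU / u) ^ 2)) <= 0).
{ intros v dx dy dU.
  set (U := fun t => cosh_dist c (line q v t)).
  set (D1 := fun t => fst v * cosh_dist_dx c (line q v t) +
                      snd v * cosh_dist_dy c (line q v t)).
  assert (Bl : locally 0 (fun t => B (line q v t))).
  { apply (continuous_line q v 0 B); rewrite line0; now apply Bo. }
  assert (U0 : U 0 = u) by (unfold U; now rewrite line0).
  assert (D10 : D1 0 = dU) by (unfold D1; now rewrite line0).
  assert (W0 : L ^ 2 - ln (U 0) ^ 2 = w) by (now rewrite U0).
  assert (dU0 : is_derive U 0 (D1 0)) by (apply is_derive_cosh_dist_line; rewrite ?line0; auto).
  destruct (second_derivative_test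
    (fun t => F (line q v t) + tau * ln (gap c L (line q v t)))
    (fun t => (fst v * partial cx F (line q v t) + snd v * partial cy F (line q v t)) +
       - (2 * tau * ln (U t) / (L ^ 2 - ln (U t) ^ 2) * (D1 t / U t)))
    ((fst v * (fst v * partial cx (partial cx F) q + snd v * partial cy (partial cx F) q) +
      snd v * (fst v * partial cx (partial cy F) q + snd v * partial cy (partial cy F) q)) +
     - ((2 * tau / w + 4 * tau * ln u ^ 2 / w ^ 2) * (dU / u) ^ 2 +
        2 * tau * ln u / w * ((u / snd q ^ 2 * (fst v ^ 2 + snd v ^ 2) +
     dy / snd q * (fst v ^ 2 - snd v ^ 2) - 2 * dx / snd q * fst v * snd v) / u - (dU / u) ^ 2))))
    as [E1 E2].
  - apply filter_imp with (2 := Bl); intros t Bt.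
    apply (is_derive_plus (V := R_NormedModule)).
    + apply (Ck_is_derive_line 2 B); auto.
    + assert (H1 := cosh_dist_ge1 c _ Hc (proj1 Bt)).
      apply (is_derive_ln_gap L tau U D1).
      * unfold U; lra.
      * exact (proj2 (gap_gt0 c _ L Hc (proj1 Bt) HL) (proj2 Bt)).
      * apply is_derive_cosh_dist_line; [exact Hc|apply Bt].
  - apply (is_derive_plus (V := R_NormedModule)).
    + apply (is_derive_plus (V := R_NormedModule)); apply is_derive_scal.
      * rewrite <- (line0 q v) at 1 2.
        apply (Ck_is_derive_line 1 B); [auto|now apply Ck_partial|now rewrite line0].
      * rewrite <- (line0 q v) at 1 2.
        apply (Ck_is_derive_line 1 B); [auto|now apply Ck_partial|now rewrite line0].
    + rewrite <- W0, <- U0, <- D10.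
      apply is_derive2_ln_gap; [rewrite U0; lra|rewrite W0; exact w0|exact dU0|].
      rewrite U0; now apply is_derive2_cosh_dist_line.
  - apply filter_imp with (2 := Bl); intros t Bt; rewrite line0; now apply Hmax.
  - rewrite W0, U0, D10, line0 in E1; split; [exact E1|exact E2]. }
assert (Ex : partial cx F q = f1 * (cosh_dist_dx c q / u)).
{ destruct (Hv (1, 0)) as [E _]; cbn [fst snd] in E.
  replace (1 * cosh_dist_dx c q + 0 * cosh_dist_dy c q) with (cosh_dist_dx c q) in E by ring.
  lra. }
assert (Ey : partial cy F q = f1 * (cosh_dist_dy c q / u)).
{ destruct (Hv (0, 1)) as [E _]; cbn [fst snd] in E.
  replace (0 * cosh_dist_dx c q + 1 * cosh_dist_dy c q) with (cosh_dist_dy c q) in E by ring.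
  lra. }
split; [exact Ex|split; [exact Ey|]].
intros v s; rewrite hessE, Ex, Ey by exact Hq.
destruct (Hv v) as [_ E].
set (dx := cosh_dist_dx c q) in *; set (dy := cosh_dist_dy c q) in *.
fold s in E; unfold H2 in Hq.
(* The Christoffel terms are the same for [F] and for the bowl, so they cancel against those in
   [hessE]. *)
replace (f2 * s ^ 2 + f1 * ((fst v ^ 2 + snd v ^ 2) / snd q ^ 2 - s ^ 2)) with
  (f2 * s ^ 2 + f1 * ((u / snd q ^ 2 * (fst v ^ 2 + snd v ^ 2) +
     dy / snd q * (fst v ^ 2 - snd v ^ 2) - 2 * dx / snd q * fst v * snd v) / u - s ^ 2)
   - f1 * (dy / u) / snd q * (fst v ^ 2 - snd v ^ 2) +
   2 * (f1 * (dx / u)) / snd q * fst v * snd v) by (field; lra).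
lra.
Qed.

(** * Barriers *)

(** The first bound is the squared gradient condition. In the second, [nabla3_swap] turns the left
    side into a difference of two values of [nabla3], each at most [2 H(n,n) sqrt (H(v,v))] in
    absolute value. *)
Lemma barrier_hess_lower_bounds (D B : R * R -> Prop) (theta : R) (F : R * R -> R)
    (p v : R * R) :
  barrier theta D F -> open B -> (forall p, B p -> D p) -> B p -> H2 p -> v <> (0, 0) ->
  let n := (- snd v, fst v) in
  let dF := partial cx F p * fst v + partial cy F p * snd v in
  0 <= dF ->
  dF ^ 2 <= theta * hess F p v v /\
  (fst v ^ 2 + snd v ^ 2) / snd p ^ 2 * dF <= 4 * hess F p n n * sqrt (hess F p v v).
Proof.
intros [theta0 [[FC [Hnn [H3 _]]] [Hpos Hgrad]]] Bo BD Bp Hp v0 n dF dF0.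
assert (Dp := BD p Bp).
assert (Hv := Hpos p v Dp v0).
assert (Hs := sqrt_lt_R0 _ Hv).
split.
- assert (Hg := Hgrad p v Dp v0); rewrite inner_gradE in Hg by exact Hp; fold dF in Hg.
  apply Rle_div_l in Hg; [|exact Hs].
  rewrite <- (pow2_sqrt theta theta0), <- (pow2_sqrt (hess F p v v)) by lra.
  rewrite <- Rpow_mult_distr; apply pow_incr; lra.
- assert (Hsw := nabla3_swap B F p v Bo (Ck_sub 3 D B F BD FC) Bp Hp); cbv zeta in Hsw; fold n dF in Hsw.
  rewrite <- Hsw.
  assert (H1 := H3 p n n v Dp); assert (H2' := H3 p v n n Dp).
  assert (Hn := sqrt_sqrt _ (Hnn p n Dp)).
  set (X := sqrt (hess F p n n)) in *; set (Z := sqrt (hess F p v v)) in *.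
  apply Rabs_le_between in H1; apply Rabs_le_between in H2'.
  rewrite <- Hn; lra.
Qed.

Lemma two_ln_le (u : R) : 0 < u -> 2 * ln u <= u ^ 2 - 1.
Proof.
intros Hu; assert (H := exp_ineq1_le (2 * ln u)).
replace (2 * ln u) with (ln u + ln u) in H at 2 by ring.
rewrite exp_plus, exp_ln in H by exact Hu; lra.
Qed.

(** Clearing denominators, the first inequality gives [8 l^2 <= 6 w] and the second
    [w^2 <= 16 t (6 w + 8 l^2) <= 192 t w]. Hence [w <= 192 t] and [l^2 <= 144 t], which add up to
    [336 t]. *)
Lemma bowl_arith (l L t : R) :
  let w := L ^ 2 - l ^ 2 in
  let K := 6 * t / w + 8 * t * l ^ 2 / w ^ 2 in
  0 < w -> 0 < t -> (4 * t * l / w) ^ 2 <= t * K -> 1 <= 16 * K -> L ^ 2 <= 336 * t.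
Proof.
intros w K w0 t0 HA HB.
assert (w2 : 0 < w ^ 2) by (apply pow_lt; exact w0).
assert (HA' : 8 * l ^ 2 <= 6 * w).
{ apply (Rmult_le_compat_r (w ^ 2 / t ^ 2)) in HA.
  2: { apply Rlt_le, Rdiv_lt_0_compat; [exact w2|now apply pow_lt]. }
  unfold K in HA.
  replace ((4 * t * l / w) ^ 2 * (w ^ 2 / t ^ 2)) with (16 * l ^ 2) in HA by (field; lra).
  replace (t * (6 * t / w + 8 * t * l ^ 2 / w ^ 2) * (w ^ 2 / t ^ 2)) with
    (6 * w + 8 * l ^ 2) in HA by (field; lra).
  lra. }
assert (HB' : w ^ 2 <= 16 * (6 * t * w + 8 * t * l ^ 2)).
{ apply (Rmult_le_compat_r (w ^ 2)) in HB; [|lra].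
  unfold K in HB.
  replace (16 * (6 * t / w + 8 * t * l ^ 2 / w ^ 2) * w ^ 2) with
    (16 * (6 * t * w + 8 * t * l ^ 2)) in HB by (field; lra).
  lra. }
assert (t * (8 * l ^ 2) <= t * (6 * w)) by (apply Rmult_le_compat_l; lra).
assert (w <= 192 * t) by nra.
unfold w in *; lra.
Qed.

(** The bowl has [tau = 2 t]; a positive [t] replaces [theta], which may be [0]. Both lower bounds
    are tested on the coordinate gradient [(dx, dy)] of [cosh_dist c] at the touching point. *)
Lemma barrier_cosh_ball (c : R * R) (L theta t : R) (F : R * R -> R) (D : R * R -> Prop) :
  H2 c -> 0 < L -> theta <= t -> 0 < t ->
  (forall p, H2 p -> cosh_dist c p <= exp L -> D p) ->
  barrier theta D F -> L ^ 2 <= 336 * t.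
Proof.
intros Hc HL Htt Ht HD FB.
assert (FC := proj1 (proj1 (proj2 FB))).
set (B := fun p => H2 p /\ cosh_dist c p < exp L).
assert (BD : forall p, B p -> D p) by (intros p [H1 H2']; apply HD; [exact H1|lra]).
assert (Bo : open B) by (now apply open_cosh_ball).
assert (FCB := Ck_sub 3 D B F BD FC).
destruct (barrier_minus_bowl_max c L (2 * t) F Hc HL ltac:(lra)) as [q [Bq Hmax]].
{ intros p H1 H2'; apply (Ck_continuous 3 D); auto. }
destruct (bowl_touching c q L (2 * t) F Hc HL ltac:(lra) FCB Bq) as [Ex [Ey Hh]].
{ intros p [H1 H2']; now apply Hmax. }
assert (Hq := proj1 Bq).
assert (u1 := cosh_dist_ge1 c q Hc Hq).
assert (w0 : 0 < gap c L q) by (apply gap_gt0; [| | |apply Bq]; auto).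
assert (HM := cosh_dist_grad_norm c q Hc Hq).
assert (Hpos := proj1 (proj2 (proj2 FB))).
set (dx := cosh_dist_dx c q) in *; set (dy := cosh_dist_dy c q) in *.
assert (Hw : gap c L q = L ^ 2 - ln (cosh_dist c q) ^ 2) by reflexivity.
set (w := gap c L q) in *; set (u := cosh_dist c q) in *.
set (l := ln u) in *.
set (f1 := 2 * (2 * t) * l / w) in *.
set (f2 := 2 * (2 * t) / w + 4 * (2 * t) * l ^ 2 / w ^ 2) in *.
set (y := snd q) in *; assert (y0 : 0 < y) by exact Hq.
(* At the center, [l] is quadratic in the distance and the bowl, even in [l], is flat to second
   order; its Hessian vanishes and cannot dominate a positive one. *)
destruct (Req_dec u 1) as [ue|une].
{ exfalso.
  assert (f10 : f1 = 0) by (unfold f1, l; rewrite ue, ln_1; field; lra).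
  assert (H := Hh (1, 0)); assert (H' := Hpos q (1, 0) (BD q Bq)).
  rewrite ue in HM; replace ((1 ^ 2 - 1) / y ^ 2) with 0 in HM by (field; lra).
  cbn [fst snd] in H; rewrite f10 in H.
  replace dx with 0 in H by nra; replace dy with 0 in H by nra.
  replace ((1 * 0 + 0 * 0) / u) with 0 in H by (field; lra).
  assert (1 <> 0 -> 0 < hess F q (1, 0) (1, 0)) by (intros H1; apply H'; intros [=]; lra).
  lra. }
assert (l0 : 0 < l) by (unfold l; rewrite <- ln_1; apply ln_increasing; lra).
assert (f10 : 0 < f1) by (apply Rdiv_lt_0_compat; nra).
set (M := dx ^ 2 + dy ^ 2) in *.
assert (uu : 0 < u ^ 2 - 1) by nra.
assert (M0 : 0 < M) by (rewrite HM; apply Rdiv_lt_0_compat; nra).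
assert (Mu : 0 < M / u) by (apply Rdiv_lt_0_compat; lra).
destruct (barrier_hess_lower_bounds D B theta F q (dx, dy) FB Bo BD Bq Hq) as [HA HB].
{ intros [= H1 H2']; unfold M in M0; rewrite H1, H2' in M0; lra. }
{ cbn [fst snd]; rewrite Ex, Ey.
  replace (_ + _) with (f1 * (M / u)) by (unfold M; field; lra); nra. }
cbn [fst snd] in HA, HB; rewrite Ex, Ey in HA, HB; fold y M in HB.
replace (f1 * (dx / u) * dx + f1 * (dy / u) * dy) with (f1 * (M / u)) in HA, HB
  by (unfold M; field; lra).
assert (HZ := Hh (dx, dy)); assert (HX := Hh (- dy, dx)); cbn [fst snd] in HZ, HX.
replace ((- dy * dx + dx * dy) / u) with 0 in HX by (field; lra).
replace ((- dy) ^ 2 + dx ^ 2) with M in HX by (unfold M; ring).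
replace ((dx * dx + dy * dy) / u) with (M / u) in HZ by (unfold M; field; lra).
fold M in HZ.
set (Z := hess F q (dx, dy) (dx, dy)) in *.
set (X := hess F q (- dy, dx) (- dy, dx)) in *.
assert (Z0 : 0 < Z) by (apply Hpos; [now apply BD|intros [= H1 H2']; unfold M in M0; rewrite H1, H2' in M0; lra]).
(* Since [dl] vanishes on [(- dy, dx)], the bowl gives [X <= f1 * (M / y ^ 2)], and this positive
   factor cancels from [HB]. *)
assert (HB' : (M / u) ^ 2 <= 16 * Z).
{ assert (Hs := sqrt_pos Z); assert (HX' : X <= f1 * (M / y ^ 2)) by lra.
  apply (Rmult_le_compat_r (sqrt Z)) in HX'; [|exact Hs].
  assert (My : 0 < M / y ^ 2 * f1) by (apply Rmult_lt_0_compat; [apply Rdiv_lt_0_compat; nra|exact f10]).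
  assert (HMu : M / u <= 4 * sqrt Z).
  { apply Rmult_le_reg_l with (M / y ^ 2 * f1); [exact My|]; lra. }
  rewrite <- (pow2_sqrt Z) by lra; nra. }
set (K := 6 * t / w + 8 * t * l ^ 2 / w ^ 2).
assert (HK : Z <= K * (M / u) ^ 2).
{ eapply Rle_trans; [exact HZ|].
  replace (M / y ^ 2) with ((1 + / (u ^ 2 - 1)) * (M / u) ^ 2).
  2: { rewrite HM; field; split; lra. }
  replace (f2 * _ + _) with ((f2 + f1 / (u ^ 2 - 1)) * (M / u) ^ 2) by (field; split; lra).
  apply Rmult_le_compat_r; [nra|].
  (* The bound [2 l <= u ^ 2 - 1] eliminates [u]: the tangential term becomes at most [2 * t / w],
     and [f2 + 2 * t / w] is [K]. *)
  assert (H : f1 / (u ^ 2 - 1) <= f1 / (2 * l)).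
  { apply Rmult_le_compat_l; [lra|]; apply Rinv_le_contravar; [lra|].
    apply two_ln_le; lra. }
  replace (f1 / (2 * l)) with (2 * t / w) in H by (unfold f1; field; lra).
  replace K with (f2 + 2 * t / w) by (unfold K, f2; field; lra); lra. }
assert (Mu2 : 0 < (M / u) ^ 2) by (apply pow_lt; exact Mu).
apply (bowl_arith l L t); rewrite <- ?Hw; trivial.
- fold K; replace (4 * t * l / w) with f1 by (unfold f1; field; lra).
  apply Rmult_le_reg_r with ((M / u) ^ 2); [exact Mu2|].
  rewrite Rpow_mult_distr in HA.
  assert (theta * Z <= t * Z) by (apply Rmult_le_compat_r; lra).
  assert (t * Z <= t * (K * (M / u) ^ 2)) by (apply Rmult_le_compat_l; lra).
  lra.
- fold K; apply Rmult_le_reg_r with ((M / u) ^ 2); [exact Mu2|]; lra.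
Qed.

Theorem corollary1p4 (r theta : R) (c : R * R) (F : R * R -> R)
    (r_gt0 : 0 < r) (c_H2 : H2 c)
    (F_barrier : barrier theta (hball c r) F) :
  theta >= 1 / 2 ^ 7 * sqrt r - 1 / 4.
Proof.
apply Rle_ge, Rnot_lt_le; intros Hlt.
assert (theta0 := proj1 F_barrier).
set (s := sqrt r) in *.
assert (Hr : r = s ^ 2) by (unfold s; now rewrite pow2_sqrt by lra).
(* As [theta] is nonnegative, the negated claim forces [s / 128 > 1 / 4]. *)
assert (s32 : 32 < s) by lra.
(* Halving the radius absorbs the factor [2] of [hball_cosh_dist]: [2 exp (r / 2) < exp r] because
   [exp (r / 2) > 2]. *)
assert (H : (r / 2) ^ 2 <= 336 * (s / 128)).
{ apply (barrier_cosh_ball c (r / 2) theta (s / 128) F (hball c r)); trivial; try lra.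
  intros p Hp Hu; apply hball_cosh_dist; trivial.
  assert (Hexp := exp_ineq1_le (r / 2)).
  replace r with (r / 2 + r / 2) at 1 by field; rewrite exp_plus.
  assert (0 < (exp (r / 2) - 2) * exp (r / 2)) by (apply Rmult_lt_0_compat; nra).
  lra. }
rewrite Hr in H.
(* With [r = s ^ 2], the bound [H] amounts to [s ^ 3 <= 10.5], far below [32 ^ 3]. *)
assert (32 ^ 3 < s ^ 3) by (simpl; nra).
nra.
Qed.
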